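(* Consider the mean-field ensemble Kalman RMLE iteration applied to the Tikhonov-regularized least-squares problem with data $\mathbf y_{\rm RLS}$, forward operator $\mathbf H_{\rm RLS}$ and weight $\boldsymbol\Gamma_{\rm RLS}$. As $i\to\infty$, for all particles $j=1,\dots,J$: (a) $\mathbb E\big[\mathbf P\widetilde{\mathbf v}_{i+1}^{(j)}\big]\to\mathbf P\boldsymbol\mu_{\rm pos}$; (b) $\mathrm{Cov}\big[\mathbf P\widetilde{\mathbf v}_{i+1}^{(j)}\big]\to\mathbf P\boldsymbol\Gamma_{\rm pos}\mathbf P^\top$, where $\boldsymbol\Gamma_{\rm pos}=(\mathbf H^\top\boldsymbol\Gamma^{-1}\mathbf H+\boldsymbol\Gamma_{\rm pr}^{-1})^{-1}$ and $\boldsymbol\mu_{\rm pos}=\boldsymbol\Gamma_{\rm pos}(\mathbf H^\top\boldsymbol\Gamma^{-1}\mathbf y+\boldsymbol\Gamma_{\rm pr}^{-1}\boldsymbol\mu_{\rm pr})$ are the posterior covariance and mean of the linear Gaussian Bayesian inverse problem $\mathbf y=\mathbf H\mathbf v+\boldsymbol\varepsilon$, $\boldsymbol\varepsilon\sim\mathcal N(\mathbf 0,\boldsymbol\Gamma)$, with prior $\mathbf v\sim\mathcal N(\boldsymbol\mu_{\rm pr},\boldsymbol\Gamma_{\rm pr})$.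
   Context: Let $\mathbf H\in\mathbb R^{n\times d}$, $\mathbf y\in\mathbb R^n$, $\boldsymbol\mu_{\rm pr}\in\mathbb R^d$, and let $\boldsymbol\Gamma\in\mathbb R^{n\times n}$, $\boldsymbol\Gamma_{\rm pr}\in\mathbb R^{d\times d}$ be symmetric positive definite. Put $$\mathbf y_{\rm RLS}=\begin{bmatrix}\mathbf y\\ \boldsymbol\mu_{\rm pr}\end{bmatrix},\quad \mathbf H_{\rm RLS}=\begin{bmatrix}\mathbf H\\ \mathbf I\end{bmatrix},\quad \boldsymbol\Gamma_{\rm RLS}=\begin{bmatrix}\boldsymbol\Gamma&\\&\boldsymbol\Gamma_{\rm pr}\end{bmatrix},\quad \mathbf A_{\rm RLS}=\mathbf H_{\rm RLS}^\top\boldsymbol\Gamma_{\rm RLS}^{-1}\mathbf H_{\rm RLS}.$$ Let $\dagger$ be the Moore–Penrose pseudoinverse. For $j=1,\dots,J$ the initial particles $\mathbf v_0^{(j)}\in\mathbb R^d$ are random with mean $\boldsymbol\mu_0\in\mathbb R^d$ and symmetric positive semidefinite covariance $\widetilde{\mathbf C}_0$; the perturbations $\boldsymbol\varepsilon^{(j)}\sim\mathcal N(\mathbf 0,\boldsymbol\Gamma_{\rm RLS})$ are i.i.d. and independent of the initial particles; $\mathbf y^{(j)}=\mathbf y_{\rm RLS}+\boldsymbol\varepsilon^{(j)}$ and $\mathbf v_\star^{(j)}=\mathbf A_{\rm RLS}^\dagger\mathbf H_{\rm RLS}^\top\boldsymbol\Gamma_{\rm RLS}^{-1}\mathbf y^{(j)}$.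 Mean-field iteration: for $i\ge 0$ define recursively $$\widetilde{\mathbf M}_i=\big(\mathbf I+\widetilde{\mathbf C}_i\mathbf A_{\rm RLS}\big)^{-1},\qquad \widetilde{\mathbf M}_{i:0}=\widetilde{\mathbf M}_i\cdots\widetilde{\mathbf M}_0,$$ $$\widetilde{\mathbf C}_{i+1}=\widetilde{\mathbf M}_{i:0}\widetilde{\mathbf C}_0\widetilde{\mathbf M}_{i:0}^\top+(\mathbf I-\widetilde{\mathbf M}_{i:0})\mathbf A_{\rm RLS}^\dagger(\mathbf I-\widetilde{\mathbf M}_{i:0})^\top,$$ $$\widetilde{\mathbf v}_{i+1}^{(j)}=\widetilde{\mathbf M}_{i:0}\mathbf v_0^{(j)}+(\mathbf I-\widetilde{\mathbf M}_{i:0})\mathbf v_\star^{(j)}.$$ Expectation and covariance are over the initial particles and the perturbations. The eigenvectors of $\widetilde{\mathbf C}_i\mathbf A_{\rm RLS}$ can be taken independent of $i$. Let $r$ be the number of strictly positive eigenvalues (independent of $i$), and $\mathbf U=[\mathbf u_1,\dots,\mathbf u_r]$ the matrix of corresponding eigenvectors, normalized so that $\mathbf U^\top\mathbf A_{\rm RLS}\mathbf U=\mathbf I_r$. Set $\mathbf P=\mathbf U\mathbf U^\top\mathbf A_{\rm RLS}$. *)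

(* Defs.v *)
From HB Require Import structures.
From mathcomp Require Import all_boot all_order all_algebra.
From mathcomp Require Import all_classical all_reals all_analysis.
From mathcomp Require Import polyorder polyrcf.

Set Implicit Arguments.
Unset Strict Implicit.
Unset Printing Implicit Defensive.

Import Order.TTheory GRing.Theory Num.Theory.
Import numFieldNormedType.Exports.

Local Open Scope classical_set_scope.
Local Open Scope ring_scope.

Section linear_algebra.
Context {R : realType}.

Definition sym_posdef d (S : 'M[R]_d) :=
  S^T = S /\ forall x : 'cV[R]_d, x != 0 -> 0 < (x^T *m S *m x) 0 0.

Definition sym_possemidef d (S : 'M[R]_d) :=
  S^T = S /\ forall x : 'cV[R]_d, 0 <= (x^T *m S *m x) 0 0.

(* The four Penrose equations. *)
Definition is_mpinv m n (A : 'M[R]_(m, n)) (X : 'M[R]_(n, m)) :=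
  [/\ A *m X *m A = A, X *m A *m X = X,
      (A *m X)^T = A *m X & (X *m A)^T = X *m A].

(* The default value 0 is never used: see [mpinvP]. *)
Definition mpinv m n (A : 'M[R]_(m, n)) : 'M[R]_(n, m) :=
  xget 0 [set X | is_mpinv A X].

Lemma gram_unitmx m n (B : 'M[R]_(m, n)) :
  \rank B = n -> B^T *m B \in unitmx.
Proof.
move=> rB; rewrite -row_free_unit -kermx_eq0; apply/rowV0P => v /sub_kermxP h.
have /eqP : v *m B^T = 0.
  apply/rowP => k; rewrite [RHS]mxE.
  have h2 : (v *m B^T) *m (v *m B^T)^T = 0.
    by rewrite trmx_mul trmxK !mulmxA -(mulmxA v) h mul0mx.
  have /eqP := congr1 (fun M : 'M[R]_1 => M 0 0) h2.
  rewrite [X in _ == X -> _]mxE mxE psumr_eq0; last first.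
    by move=> i _; rewrite [_^T _ _]mxE -expr2 sqr_ge0.
  by move=> /allP/(_ k (mem_index_enum _)) /=; rewrite [_^T _ _]mxE mulf_eq0 orbb => /eqP.
have fB : row_free B^T by rewrite /row_free mxrank_tr rB.
by rewrite (mulmx_free_eq0 v fB) => /eqP.
Qed.

Lemma full_rank_mpinv m k n (C : 'M[R]_(m, k)) (D : 'M[R]_(k, n)) :
  C^T *m C \in unitmx -> D *m D^T \in unitmx ->
  is_mpinv (C *m D)
    (D^T *m invmx (D *m D^T) *m (invmx (C^T *m C) *m C^T)).
Proof.
move=> uC uD; set X := _ *m (_ *m _).
have AX : C *m D *m X = C *m invmx (C^T *m C) *m C^T.
  rewrite -[C *m D *m X]mulmxA /X !(mulmxA D) mulmxV // mul1mx.
  by rewrite mulmxA.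
have XA : X *m (C *m D) = D^T *m invmx (D *m D^T) *m D.
  by rewrite mulmxA /X -!mulmxA (mulmxA C^T) mulKmx // !mulmxA.
split.
- by rewrite AX !mulmxA -(mulmxA _ C^T C) mulmxKV.
- by rewrite XA /X !mulmxA -(mulmxA _ D D^T) mulmxKV.
- by rewrite AX !trmx_mul trmxK trmx_inv trmx_mul trmxK mulmxA.
- by rewrite XA !trmx_mul trmxK trmx_inv trmx_mul trmxK mulmxA.
Qed.

Lemma mpinvP m n (A : 'M[R]_(m, n)) : is_mpinv A (mpinv A).
Proof.
rewrite /mpinv; apply: (@xgetPex _ 0 [set X | is_mpinv A X]).
have /full_rank_mpinv h : (col_base A)^T *m col_base A \in unitmx.
  by apply: gram_unitmx; apply/eqP; exact: col_base_full.
have /h {}h : row_base A *m (row_base A)^T \in unitmx.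
  rewrite -{1}[row_base A]trmxK; apply: gram_unitmx; rewrite mxrank_tr.
  by apply/eqP; exact: row_base_free.
by rewrite mulmx_base in h; eexists; exact: h.
Qed.

(* Number of strictly positive eigenvalues, counted with algebraic
   multiplicity; [rootsR p] lists the distinct real roots of p. *)
Definition nb_pos_eigenvalues d (M : 'M[R]_d) : nat :=
  (\sum_(x <- rootsR (char_poly M) | (0 < x)%R) (\mu_x (char_poly M))%R)%N.

(* mathcomp's [eigenspace] is about row vectors; these are column ones. *)
Definition pos_eigenvector d (M : 'M[R]_d) (u : 'cV[R]_d) :=
  u != 0 /\ exists2 l : R, 0 < l & M *m u = l *: u.

End linear_algebra.

Section random_vectors.
Context {R : realType} {disp : measure_display} {T : measurableType disp}.
Variable Pr : probability T R.

Definition random_vector m (X : T -> 'cV[R]_m) :=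
  forall k, measurable_fun setT (fun w => X w k 0).

Definition square_integrable m (X : T -> 'cV[R]_m) :=
  forall k, (fun w => X w k 0) \in Lfun Pr 2%:E.

(* Extended-real entries, as for the scalar notions: no finiteness is
   presupposed. *)
Definition mean_vec m (X : T -> 'cV[R]_m) : 'cV[\bar R]_m :=
  \col_k 'E_Pr[fun w => X w k 0%R]%E.

Definition cov_mx m (X : T -> 'cV[R]_m) : 'M[\bar R]_m :=
  \matrix_(k, l) covariance Pr (fun w => X w k 0) (fun w => X w l 0).

(* One-dimensional normal law given by its mean and its *variance* v, the
   Dirac mass when v = 0 ([normal_prob] takes the standard deviation, and is
   not a Dirac mass when that is 0). *)
Definition normal_law (Y : T -> R) (m v : R) :=
  forall B : set R, measurable B ->
    Pr (Y @^-1` B) =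
      if v == 0 then \d_m B else normal_prob m (Num.sqrt v) B.

(* X ~ N(mu, S): every linear form of X is normal. *)
Definition gaussian_vector m (X : T -> 'cV[R]_m)
    (mu : 'cV[R]_m) (S : 'M[R]_m) :=
  random_vector X /\
  forall a : 'cV[R]_m, normal_law (fun w => (a^T *m X w) 0 0)
    ((a^T *m mu) 0 0) ((a^T *m S *m a) 0 0).

Definition sigma_of (I : Type) (X : I -> T -> R) : set (set T) :=
  <<s \bigcup_i preimage_set_system setT (X i) measurable >>.

Definition sigma_of_vector m (X : T -> 'cV[R]_m) : set (set T) :=
  sigma_of (fun (k : 'I_m) w => X w k 0).

Definition sigma_of_family (J : nat) m (X : 'I_J -> T -> 'cV[R]_m) :
    set (set T) :=
  sigma_of (fun (jk : 'I_J * 'I_m) w => X jk.1 w jk.2 0).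

Definition independent (F G : set (set T)) :=
  forall A B, F A -> G B -> (Pr (A `&` B) = Pr A * Pr B)%E.

Definition mutually_independent (I : finType) (F : I -> set (set T)) :=
  forall (S : {set I}) (E : I -> set T), (forall i, i \in S -> F i (E i)) ->
    (Pr (\bigcap_(i in [set` S]) E i) = \prod_(i in S) Pr (E i))%E.

End random_vectors.

Section regularized_problem.
Context {R : realType} {n d : nat}.
Variables (H : 'M[R]_(n, d)) (y : 'cV[R]_n) (mu_pr : 'cV[R]_d).
Variables (Gam : 'M[R]_n) (Gam_pr : 'M[R]_d).

Definition y_RLS : 'cV[R]_(n + d) := col_mx y mu_pr.

Definition H_RLS : 'M[R]_(n + d, d) := col_mx H 1%:M.

Definition Gam_RLS : 'M[R]_(n + d) := block_mx Gam 0 0 Gam_pr.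

Definition A_RLS : 'M[R]_d := H_RLS^T *m invmx Gam_RLS *m H_RLS.

(* Weighted least-squares solution for the data z. *)
Definition v_star (z : 'cV[R]_(n + d)) : 'cV[R]_d :=
  mpinv A_RLS *m H_RLS^T *m invmx Gam_RLS *m z.

Definition Gam_pos : 'M[R]_d := invmx (H^T *m invmx Gam *m H + invmx Gam_pr).

Definition mu_pos : 'cV[R]_d :=
  Gam_pos *m (H^T *m invmx Gam *m y + invmx Gam_pr *m mu_pr).

End regularized_problem.

Section mean_field.
Context {R : realType} {d : nat}.
Variables (A C0 : 'M[R]_d).

(* The pair (C_i, M_{i-1} ... M_0); the empty product (i = 0) is I. *)
Fixpoint mf_state (i : nat) : 'M[R]_d * 'M[R]_d :=
  if i is i'.+1 then
    let: (C, N) := mf_state i' in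
    let N' := invmx (1%:M + C *m A) *m N in
    (N' *m C0 *m N'^T + (1%:M - N') *m mpinv A *m (1%:M - N')^T, N')
  else (C0, 1%:M).

Definition mf_cov i := (mf_state i).1.

Definition mf_M i := invmx (1%:M + mf_cov i *m A).

(* [mf_Mprod i.+1] is M_{i:0} = M_i ... M_0. *)
Definition mf_Mprod i := (mf_state i).2.

Lemma mf_MprodS i : mf_Mprod i.+1 = mf_M i *m mf_Mprod i.
Proof. by rewrite /mf_Mprod /mf_M /mf_cov /=; case: (mf_state i). Qed.

Lemma mf_covS i : mf_cov i.+1 =
  mf_Mprod i.+1 *m C0 *m (mf_Mprod i.+1)^T +
  (1%:M - mf_Mprod i.+1) *m mpinv A *m (1%:M - mf_Mprod i.+1)^T.
Proof. by rewrite /mf_Mprod /mf_cov /=; case: (mf_state i). Qed.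

(* The i-th iterate of a particle; equal to v0 for i = 0. *)
Definition mf_particle i (v0 vs : 'cV[R]_d) : 'cV[R]_d :=
  mf_Mprod i *m v0 + (1%:M - mf_Mprod i) *m vs.

End mean_field.

(* Main.v *)
Require Import Defs.
From HB Require Import structures.
From mathcomp Require Import all_boot all_order all_algebra.
From mathcomp Require Import ring lra.
From mathcomp Require Import all_classical all_reals all_analysis measurable_realfun.

Import Order.TTheory GRing.Theory Num.Theory.
Import numFieldNormedType.Exports.

(** Write A for the regularized normal matrix, N_i for the product of the first
    i mean-field maps and z_star for the randomized least-squares solution of
    one particle, so that the particle is N_i v_0 + (I - N_i) z_star.  The
    theorem holds because P N_i tends to 0: the projection of the particle
    forgets its initial position, and what remains in the limit is P z_star.

    Why P z_star has the right moments.  A is the posterior precision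
    (A_RLSE); it is positive definite, so its pseudoinverse is the posterior
    covariance A^-1.  Hence z_star is affine in the Gaussian perturbation with
    mean mu_pos (v_star_y_RLS) and covariance A^-1 A A^-1 = Gam_pos
    (v_star_noise_cov).  The moments of the perturbation itself are read off
    the definition of a Gaussian vector, in which every linear form is normal;
    they rest on the second moment of the normal density, obtained by
    integration by parts (integral_sqr_normal_pdf).

    Why P N_i tends to 0.  If C_0 A u = l u with l > 0, then u is a right
    eigenvector and u^T A a left eigenvector of every N_i, for the same
    eigenvalue s_i, and C_i A u = c_i u with c_i = s_i^2 l + (1 - s_i)^2
    (mf_Mprod_eigen).  So s_(i+1) = s_i / (1 + c_i), and since c_i is never
    below l / (1 + l), the s_i decay geometrically (shrink_le).  As
    P = U (U^T A), the matrix P N_i is U diag(s_i) U^T A, which vanishes in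
    the limit (cvg_mf_Mprod_proj).

    To pass to the limit, stack Z = (v_0, z_star).  This is a square-integrable
    vector that does not depend on i, and P v_i = L_i Z where the block row
    L_i = (P N_i, P - P N_i) tends to (0, P).  The moments of L_i Z are
    L_i E[Z] and L_i Cov[Z] L_i^T, polynomial in L_i, so they converge to the
    moments of (0, P) Z = P z_star. *)

Set Implicit Arguments.
Unset Strict Implicit.
Unset Printing Implicit Defensive.

Local Open Scope classical_set_scope.
Local Open Scope ring_scope.

(** * Definite matrices *)

Section definite_matrices.
Context {R : realType}.

Lemma unitmx_inj_col d (M : 'M[R]_d) :
  (forall x : 'cV[R]_d, M *m x = 0 -> x = 0) -> M \in unitmx.
Proof.
move=> injM; rewrite -unitmx_tr -row_free_unit -kermx_eq0.
apply/rowV0P => v /sub_kermxP vM.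
apply: trmx_inj; rewrite trmx0; apply: injM.
by rewrite -(trmxK M) -trmx_mul vM trmx0.
Qed.

Lemma posdef_unitmx d (S : 'M[R]_d) : sym_posdef S -> S \in unitmx.
Proof.
move=> [_ Spos]; apply: unitmx_inj_col => x Sx0; apply/eqP/contraT => /Spos.
by rewrite -mulmxA Sx0 mulmx0 mxE ltxx.
Qed.

Lemma posdef_possemidef d (S : 'M[R]_d) : sym_posdef S -> sym_possemidef S.
Proof.
move=> [Ssym Spos]; split=> // x; have [->|/Spos/ltW//] := eqVneq x 0.
by rewrite mulmx0 mxE.
Qed.

Lemma posdef_invmx d (S : 'M[R]_d) : sym_posdef S -> sym_posdef (invmx S).
Proof.
move=> Spd; have uS := posdef_unitmx Spd; case: Spd => Ssym Spos.
split=> [|x x0]; first by rewrite trmx_inv Ssym.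
have : invmx S *m x != 0.
  by apply: contraNneq x0 => x0; rewrite -(mulKVmx uS x) x0 mulmx0.
by move/Spos; rewrite trmx_mul trmx_inv Ssym -!mulmxA mulKVmx // !mulmxA.
Qed.

Lemma possemidef_congr m d (S : 'M[R]_d) (L : 'M[R]_(m, d)) :
  sym_possemidef S -> sym_possemidef (L *m S *m L^T).
Proof.
move=> [Ssym Spos]; split=> [|x]; first by rewrite !trmx_mul trmxK Ssym mulmxA.
by have := Spos (L^T *m x); rewrite trmx_mul trmxK !mulmxA.
Qed.

Lemma possemidefD d (S S' : 'M[R]_d) :
  sym_possemidef S -> sym_possemidef S' -> sym_possemidef (S + S').
Proof.
move=> [Ssym Spos] [Ssym' Spos']; split=> [|x].
  by rewrite linearD/= Ssym Ssym'.
by rewrite mulmxDr mulmxDl mxE addr_ge0.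
Qed.

Lemma posdefDl d (S S' : 'M[R]_d) :
  sym_possemidef S -> sym_posdef S' -> sym_posdef (S + S').
Proof.
move=> [Ssym Spos] [Ssym' Spos']; split=> [|x x0].
  by rewrite linearD/= Ssym Ssym'.
by rewrite mulmxDr mulmxDl mxE ltr_wpDl ?Spos'.
Qed.

Lemma posdef_mpinv d (S : 'M[R]_d) : sym_posdef S -> mpinv S = invmx S.
Proof.
move=> /posdef_unitmx uS; have [SXS _ _ _] := mpinvP S.
by rewrite -[LHS](mulKmx uS) -[in LHS](mulmxK uS (S *m _)) SXS mulmxV // mulmx1.
Qed.

(** A kernel vector x satisfies x = - C A x, hence
    x^T A x = - (A x)^T C (A x) <= 0, which forces x = 0. *)
Lemma one_add_mul_unitmx d (C A : 'M[R]_d) :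
  sym_possemidef C -> sym_posdef A -> 1%:M + C *m A \in unitmx.
Proof.
move=> [_ Cpos] [Asym Apos]; apply: unitmx_inj_col => x.
rewrite mulmxDl mul1mx => /eqP; rewrite addr_eq0 => /eqP xE.
apply/eqP/contraT => /Apos; rewrite ltNge => /negP[].
rewrite {2}xE mulmxN mxE oppr_le0.
by have := Cpos (A *m x); rewrite trmx_mul Asym !mulmxA.
Qed.

End definite_matrices.

(** * The regularized normal equations *)

Lemma Gam_RLS_possemidef (R : realType) n d (Gam : 'M[R]_n) (Gam_pr : 'M[R]_d) :
  sym_possemidef Gam -> sym_possemidef Gam_pr ->
  sym_possemidef (Gam_RLS Gam Gam_pr).
Proof.
move=> [Gsym Gpos] [Psym Ppos]; split=> [|x].
  by rewrite tr_block_mx !trmx0 Gsym Psym.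
rewrite -(vsubmxK x) tr_col_mx mul_row_block !mulmx0 addr0 add0r.
by rewrite mul_row_col mxE addr_ge0.
Qed.

Section regularized_problem.
Context {R : realType} {n d : nat}.
Variables (H : 'M[R]_(n, d)) (y : 'cV[R]_n) (mu_pr : 'cV[R]_d).
Variables (Gam : 'M[R]_n) (Gam_pr : 'M[R]_d).
Hypotheses (hGam : sym_posdef Gam) (hGam_pr : sym_posdef Gam_pr).

Let A := A_RLS H Gam Gam_pr.
Let K := mpinv A *m (H_RLS H)^T *m invmx (Gam_RLS Gam Gam_pr).

Lemma Gam_RLS_unitmx : Gam_RLS Gam Gam_pr \in unitmx.
Proof. by rewrite block_diag_mx_unit !posdef_unitmx. Qed.

Lemma invmx_Gam_RLS :
  invmx (Gam_RLS Gam Gam_pr) = block_mx (invmx Gam) 0 0 (invmx Gam_pr).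
Proof. exact: invmx_block_diag Gam_RLS_unitmx. Qed.

Lemma A_RLSE : A = H^T *m invmx Gam *m H + invmx Gam_pr.
Proof.
rewrite /A /A_RLS invmx_Gam_RLS /H_RLS tr_col_mx mul_row_block !mulmx0 addr0.
by rewrite add0r mul_row_col trmx1 mul1mx mulmx1.
Qed.

Lemma A_RLS_posdef : sym_posdef A.
Proof.
rewrite A_RLSE; apply: posdefDl; last exact: posdef_invmx.
have := possemidef_congr H^T (posdef_possemidef (posdef_invmx hGam)).
by rewrite trmxK.
Qed.

Lemma mpinv_A_RLS : mpinv A = Gam_pos H Gam Gam_pr.
Proof. by rewrite (posdef_mpinv A_RLS_posdef) A_RLSE. Qed.

Lemma v_star_y_RLS :
  v_star H Gam Gam_pr (y_RLS y mu_pr) = mu_pos H y mu_pr Gam Gam_pr.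
Proof.
rewrite /v_star mpinv_A_RLS /mu_pos -!mulmxA; congr (_ *m _).
rewrite invmx_Gam_RLS /H_RLS tr_col_mx mul_block_col !mul0mx addr0 add0r.
by rewrite mul_row_col trmx1 mul1mx.
Qed.

(** [K] maps the perturbation to the random part of the particle's target, so
    this is the covariance of the target; it telescopes to A^-1 A A^-1. *)
Lemma v_star_noise_cov : K *m Gam_RLS Gam Gam_pr *m K^T = Gam_pos H Gam Gam_pr.
Proof.
have [Asym _] := A_RLS_posdef; have uA := posdef_unitmx A_RLS_posdef.
have Gsym : (invmx (Gam_RLS Gam Gam_pr))^T = invmx (Gam_RLS Gam Gam_pr).
  rewrite trmx_inv tr_block_mx !trmx0.
  by case: hGam => -> _; case: hGam_pr => -> _.
rewrite -mpinv_A_RLS /K mulmxKV ?Gam_RLS_unitmx // !trmx_mul trmxK Gsym.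
rewrite (posdef_mpinv A_RLS_posdef) trmx_inv Asym.
transitivity (invmx A *m A *m invmx A); first by rewrite {2}/A /A_RLS !mulmxA.
by rewrite mulVmx // mul1mx.
Qed.

End regularized_problem.

(** * Limits of matrices, entry by entry *)

Section matrix_limits.
Context {S : Type} {F : set_system S} {FF : Filter F}.

Lemma cvg_mx_entries (T : topologicalType) m n (f : S -> 'M[T]_(m, n))
    (l : 'M[T]_(m, n)) :
  (forall i j, f x i j @[x --> F] --> l i j) -> f x @[x --> F] --> l.
Proof.
move=> fl B [P lP sPB]; apply: (@filterS _ F _ _ _ (fun x => sPB (f x))).
by apply: filter_forall => i; apply: filter_forall => j; exact: fl.
Qed.

Lemma cvg_mulmx_entries (R : realType) m n p
    (f : S -> 'M[R]_(m, n)) (g : S -> 'M[R]_(n, p))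
    (a : 'M[R]_(m, n)) (b : 'M[R]_(n, p)) :
  (forall i j, f x i j @[x --> F] --> a i j) ->
  (forall i j, g x i j @[x --> F] --> b i j) ->
  forall i j, (f x *m g x) i j @[x --> F] --> (a *m b) i j.
Proof.
move=> fa gb i j; under eq_fun do rewrite mxE; rewrite mxE.
apply: cvg_big => [|k _]; first exact: add_continuous.
exact: cvgM.
Qed.

Lemma cvg_map_EFin_entries (R : realType) m n (f : S -> 'M[R]_(m, n))
    (l : 'M[R]_(m, n)) :
  (forall i j, f x i j @[x --> F] --> l i j) ->
  map_mx EFin (f x) @[x --> F] --> map_mx EFin l.
Proof.
move=> fl; apply: cvg_mx_entries => i j; rewrite [X in _ --> X]mxE.
under eq_fun do rewrite mxE.
by apply/cvg_EFin; [exact: nearW|exact: fl].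
Qed.

End matrix_limits.

(** * Decay of the mean-field products along positive eigenvectors *)

Section mean_field_eigenvectors.
Context {R : realType} {d : nat}.
Variables (A C0 : 'M[R]_d).
Hypotheses (Apd : sym_posdef A) (C0psd : sym_possemidef C0).

Let N i : 'M[R]_d := mf_Mprod A C0 i.
Let C i : 'M[R]_d := mf_cov A C0 i.

(** At i = 0 the empty product is the identity, so the formula defining the
    covariance at positive times holds there too; this spares every later
    argument a separate initial case. *)
Lemma mf_covE i :
  C i = N i *m C0 *m (N i)^T + (1%:M - N i) *m invmx A *m (1%:M - N i)^T.
Proof.
rewrite -(posdef_mpinv Apd) /C /N; case: i => [|i]; last exact: mf_covS.
by rewrite /mf_cov /mf_Mprod /= subrr !mul0mx addr0 trmx1 mulmx1 mul1mx.
Qed.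

Lemma mf_cov_possemidef i : sym_possemidef (C i).
Proof.
rewrite mf_covE; apply: possemidefD; apply: possemidef_congr => //.
exact/posdef_possemidef/posdef_invmx.
Qed.

(** Eigenvalue of the product of the first i mean-field maps on an eigenvector
    of C_0 A for l.  The divisor is 1 + c, where c is the eigenvalue of C_i A on
    the same vector. *)
Fixpoint shrink (l : R) (i : nat) : R :=
  if i is i'.+1 then
    let s := shrink l i' in s / (1 + (s ^+ 2 * l + (1 - s) ^+ 2))
  else 1.

Lemma shrink_ge0 (l : R) i : 0 < l -> 0 <= shrink l i.
Proof.
move=> l0; elim: i => [//|i IH /=].
rewrite divr_ge0 // addr_ge0 // addr_ge0 ?sqr_ge0 // mulr_ge0 ?sqr_ge0 //.
exact: ltW.
Qed.

Lemma shrink_le (l : R) i : 0 < l -> shrink l i <= (1 + l / (1 + l))^-1 ^+ i.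
Proof.
move=> l0; have l1 : 0 < 1 + l by rewrite addr_gt0.
have q0 : 0 < 1 + l / (1 + l) by rewrite addr_gt0 ?divr_gt0.
elim: i => [|i IH] //=; rewrite [leRHS]exprSr; set s := shrink l i in IH *.
(* The quadratic s ^+ 2 * l + (1 - s) ^+ 2 is minimal at s = 1 / (1 + l). *)
have cge : l / (1 + l) <= s ^+ 2 * l + (1 - s) ^+ 2.
  rewrite ler_pdivrMr // -subr_ge0.
  rewrite (_ : _ - _ = ((1 + l) * s - 1) ^+ 2) ?sqr_ge0 //; ring.
apply: ler_pM => //; first exact: shrink_ge0.
- by rewrite invr_ge0 addr_ge0 // (le_trans _ cge) // divr_ge0 ?ltW.
- by rewrite lef_pV2 ?posrE ?lerD2l // (lt_le_trans q0) ?lerD2l.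
Qed.

Lemma cvg_shrink (l : R) : 0 < l -> shrink l i @[i --> \oo] --> 0.
Proof.
move=> l0; have l1 : 0 < l / (1 + l) by rewrite divr_gt0 ?addr_gt0.
apply: (@squeeze_cvgr _ _ _ _ (cst 0) (GRing.exp (1 + l / (1 + l))^-1)).
- by near=> i; rewrite /= shrink_ge0 ?shrink_le.
- exact: cvg_cst.
- apply: cvg_expr; rewrite ger0_norm ?invr_ge0 ?addr_ge0 ?ltW //.
  by rewrite invf_lt1 ?ltrDl ?addr_gt0.
Unshelve. all: by end_near. Qed.

Lemma invmx_eigen (M : 'M[R]_d) (u : 'cV[R]_d) (a : R) :
  M \in unitmx -> a != 0 -> M *m u = a *: u -> invmx M *m u = a^-1 *: u.
Proof.
move=> uM a0 Mu; rewrite -[in RHS](mulKmx uM u) Mu -scalemxAr scalerA.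
by rewrite mulVf // scale1r.
Qed.

(** The left eigenvector [A *m u] has to be carried along with [u]: the
    covariance C_i contains both N_i and its transpose, and the transpose meets
    the vector [A *m u] in C_i A u.  With both in hand, the defining formula gives
    C_i A u = (s^2 l + (1 - s)^2) u, and the symmetry of C_i and A transfers this
    to the left eigenvector. *)
Lemma mf_Mprod_eigen (l : R) (u : 'cV[R]_d) i :
  0 < l -> C0 *m A *m u = l *: u ->
  N i *m u = shrink l i *: u /\ (N i)^T *m (A *m u) = shrink l i *: (A *m u).
Proof.
move=> l0 C0u; have [Asym _] := Apd; have uA := posdef_unitmx Apd.
elim: i => [|i [Nu NAu]].
  by rewrite /N /mf_Mprod /= trmx1 !mul1mx !scale1r.
set s := shrink l i in Nu NAu.
set c := s ^+ 2 * l + (1 - s) ^+ 2.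
have c0 : 1 + c != 0.
  rewrite gt_eqF // ltr_wpDr // addr_ge0 ?sqr_ge0 // mulr_ge0 ?sqr_ge0 //.
  exact: ltW.
have NcAu : (1%:M - N i)^T *m (A *m u) = (1 - s) *: (A *m u).
  by rewrite linearB/= trmx1 mulmxBl mul1mx NAu scalerBl scale1r.
have Ncu : (1%:M - N i) *m u = (1 - s) *: u.
  by rewrite mulmxBl mul1mx Nu scalerBl scale1r.
have Cu : C i *m (A *m u) = c *: u.
  rewrite mf_covE mulmxDl -!mulmxA NAu NcAu -!scalemxAr (mulmxA C0) C0u mulKmx //.
  by rewrite -scalemxAr Nu Ncu !scalerA -scalerDl; congr (_ *: _); rewrite /c; ring.
have M1 : (1%:M + C i *m A) *m u = (1 + c) *: u.
  by rewrite mulmxDl mul1mx -mulmxA Cu scalerDl scale1r.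
have M2 : (1%:M + C i *m A)^T *m (A *m u) = (1 + c) *: (A *m u).
  have [Csym _] := mf_cov_possemidef i.
  rewrite linearD/= trmx1 trmx_mul Asym Csym mulmxDl mul1mx -mulmxA Cu.
  by rewrite -scalemxAr scalerDl scale1r.
have uM : 1%:M + C i *m A \in unitmx.
  by apply: one_add_mul_unitmx => //; exact: mf_cov_possemidef.
rewrite /N mf_MprodS /mf_M -/(C i) -/(N i) trmx_mul trmx_inv -!mulmxA.
rewrite Nu -scalemxAr (invmx_eigen uM c0 M1).
rewrite (invmx_eigen _ c0 M2) ?unitmx_tr // -scalemxAr NAu.
by rewrite !scalerA /= -/s -/c [_^-1 * s]mulrC.
Qed.

(** The rows of U^T A are left eigenvectors of N_i, so multiplying by N_i on
    the right only scales them. *)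
Lemma cvg_mf_Mprod_proj r (U : 'M[R]_(d, r)) :
  (forall k, pos_eigenvector (C0 *m A) (col k U)) ->
  forall a b, (U *m U^T *m A *m N i) a b @[i --> \oo] --> (0 : R).
Proof.
move=> eigU; have [Asym _] := Apd.
have /choice[l lP] k : exists l : R, 0 < l /\ C0 *m A *m col k U = l *: col k U.
  by have [_ [l l0 lU]] := eigU k; exists l.
have UAN i : U^T *m A *m N i = diag_mx (\row_k shrink (l k) i) *m (U^T *m A).
  apply/row_matrixP => k; have [l0 C0u] := lP k.
  have [_ NAu] := mf_Mprod_eigen i l0 C0u.
  rewrite row_mul [in RHS]row_mul row_diag_mx mxE -scalemxAl -rowE.
  rewrite !row_mul -tr_col -(trmxK (N i)) -Asym -!trmx_mul.
  by rewrite NAu linearZ.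
move=> a b.
have -> : (fun i => (U *m U^T *m A *m N i) a b) =
    (fun i => (U *m (diag_mx (\row_k shrink (l k) i) *m (U^T *m A))) a b).
  by apply/funext => i; rewrite -UAN !mulmxA.
have -> : 0 = (U *m (0 *m (U^T *m A))) a b by rewrite mul0mx mulmx0 mxE.
apply: cvg_mulmx_entries => [i j|]; first exact: cvg_cst.
apply: cvg_mulmx_entries => [i j|i j]; last exact: cvg_cst.
under eq_fun do rewrite !mxE; rewrite mxE.
have [_|_] := eqVneq i j; last by under eq_fun do rewrite mulr0n; exact: cvg_cst.
by under eq_fun do rewrite mulr1n; apply: cvg_shrink; case: (lP i).
Qed.

End mean_field_eigenvectors.

(** * Second moment of the normal density *)

(** The density [g] agrees almost everywhere with the Radon-Nikodym derivative of
    [nu], for which the change of variables is available. *)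
Lemma ge0_integral_density d (T : measurableType d) (R : realType)
    (nu : {finite_measure set T -> \bar R})
    (mu : {sigma_finite_measure set T -> \bar R})
    (g : T -> R) (f : T -> \bar R) :
  mu.-integrable setT (EFin \o g) ->
  (forall A, measurable A -> nu A = \int[mu]_(x in A) (g x)%:E)%E ->
  measurable_fun setT f -> (forall x, 0 <= f x)%E ->
  (\int[nu]_x f x = \int[mu]_x (f x * (g x)%:E))%E.
Proof.
move=> ig nuE mf f0.
have numu : nu `<< mu.
  apply/null_content_dominatesP => B mB muB0; rewrite nuE //.
  by apply: null_set_integral => //; apply/measurable_funTS/(measurable_int _ ig).
rewrite -(Radon_Nikodym_SigmaFinite.change_of_variables numu f0) //.
have ih := Radon_Nikodym_SigmaFinite.f_integrable numu.
apply: ae_eq_integral => //.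
- exact: emeasurable_funM (measurable_int _ ih).
- exact: emeasurable_funM (measurable_int _ ig).
apply: ae_eqe_mul2l; apply: integral_ae_eq => //.
- exact: measurable_int ig.
- by move=> B _ mB; rewrite -nuE // (Radon_Nikodym_SigmaFinite.f_integral numu).
Qed.

Section normal_moments.
Context {R : realType}.
Variable s : R.
Hypothesis s0 : s != 0.
Let p : R -> R := normal_pdf 0 s.

Lemma is_derive_normal_pdf (x : R) : is_derive x 1 p (- (x / s ^+ 2 * p x)).
Proof.
have q' : is_derive x 1 (fun y : R => - (s ^+ 2 *+ 2)^-1 * y ^+ 2) (- (x / s ^+ 2)).
  apply: is_derive_eq; rewrite /GRing.scale /= !mulr1 -mulr_natr; field.
  by rewrite s0.
have -> : p = normal_peak s \o* (expR \o (fun y : R => - (s ^+ 2 *+ 2)^-1 * y ^+ 2)).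
  apply/funext => y; rewrite /p normal_pdfE // /normal_fun /= subr0.
  by rewrite [LHS]mulrC; congr (expR _ * _); rewrite !mulNr mulrC.
have e' := is_derive1_comp (is_derive_expR _) q'.
apply: is_derive_eq => /=; rewrite scaler0 add0r /GRing.scale /=; ring.
Qed.

Lemma cvg_id_normal_pdf : n.+1%:R * p n.+1%:R @[n --> \oo] --> (0 : R).
Proof.
(* From 1 + t <= exp t with t = x^2 / (2 s^2), the density at x is at most
   a constant over x^2. *)
have bound n : n.+1%:R * p n.+1%:R <= normal_peak s * (s ^+ 2 *+ 2) * harmonic n.
  rewrite /p normal_pdfE // /normal_fun subr0 mulNr expRN.
  set t := n.+1%:R ^+ 2 / (s ^+ 2 *+ 2).
  have t0 : 0 < t by rewrite divr_gt0 ?exprn_gt0 // pmulrn_lgt0 // exprn_even_gt0.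
  have : (expR t)^-1 <= t^-1.
    by rewrite lef_pV2 ?posrE ?expR_gt0 // (le_trans _ (expR_ge1Dx t)) // lerDr.
  move=> /(ler_wpM2l (normal_peak_ge0 s)) /(ler_wpM2l (ler0n R n.+1)) /le_trans; apply.
  rewrite /t /= le_eqVlt; apply/orP; left; apply/eqP.
  rewrite -[s ^+ 2 *+ 2]mulr_natr; field.
  by rewrite nat1r pnatr_eq0 s0.
apply: (@squeeze_cvgr _ _ _ _ (cst 0)
  (fun n => normal_peak s * (s ^+ 2 *+ 2) * harmonic n)).
- by near=> n; rewrite bound mulr_ge0 // normal_pdf_ge0.
- exact: cvg_cst.
- rewrite -[0 in X in _ --> X](mulr0 (normal_peak s * (s ^+ 2 *+ 2))).
  by apply: cvgMr; exact: cvg_harmonic.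
Unshelve. all: by end_near. Qed.

(** Since x p(x) is the derivative of - s^2 p(x), integrating x * (x p(x)) by
    parts over [-n, n] gives s^2 times the mass of [-n, n], up to a boundary term
    of order n p(n) that vanishes; both integrals converge monotonically. *)
Lemma integral_sqr_normal_pdf :
  (\int[lebesgue_measure]_x ((x ^+ 2)%:E * (p x)%:E) = (s ^+ 2)%:E)%E.
Proof.
have p0 x : 0 <= p x by exact: normal_pdf_ge0.
have mp : measurable_fun [set: R] p by exact: measurable_normal_pdf.
pose I n : set R := `[- n.+1%:R, n.+1%:R]%classic.
have nnI : {homo I : m n / (m <= n)%N >-> (m <= n)%O}.
  move=> m n mn; rewrite subsetEset; apply: subset_itv; rewrite bnd_simp.
    by rewrite lerN2 ler_nat.
  by rewrite ler_nat.
have UI : \bigcup_n I n = [set: R].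
  apply/seteqP; split=> // x _; exists (Num.bound `|x|) => //=.
  rewrite /I /= in_itv /= -ler_norml.
  apply/ltW/(lt_trans (archi_boundP (normr_ge0 x))) => //.
  by rewrite ltr_nat.
have mI n : measurable (I n) by exact: measurable_itv.
have parts n : (\int[lebesgue_measure]_(x in I n) ((x ^+ 2)%:E * (p x)%:E) =
    (- (s ^+ 2 *+ 2) * (n.+1%:R * p n.+1%:R))%:E +
    (s ^+ 2)%:E * \int[lebesgue_measure]_(x in I n) (p x)%:E)%E.
  have p' (x : R) := is_derive_normal_pdf x.
  have cp : continuous p by exact: continuous_normal_pdf.
  have cid : continuous (fun x : R => x) by move=> x; exact: cvg_id.
  have G' (x : R) : is_derive x 1 (fun x : R => - s ^+ 2 * p x) (x * p x).
    by apply: is_derive_eq; rewrite /GRing.scale /=; field.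
  have ab : - n.+1%:R < n.+1%:R :> R by rewrite gtrN.
  have parts := @integration_by_parts R id (fun x => - s ^+ 2 * p x) (cst 1)
    (fun x => x * p x) _ _ ab.
  transitivity (\int[lebesgue_measure]_(x in I n) (x * (x * p x))%:E)%E.
    by apply: eq_integral => x _; rewrite mulrA EFinM.
  have LR (f df : R -> R) : (forall x : R, is_derive x 1 f (df x)) ->
      derivable_oo_LRcontinuous f (- n.+1%:R) n.+1%:R.
    move=> f'; have cf (x : R) : {for x, continuous f}.
      by apply: differentiable_continuous; apply/derivable1_diffP; case: (f' x).
    split; first by move=> x _; case: (f' x).
    - by apply: cvg_at_right_filter; exact: cf.
    - by apply: cvg_at_left_filter; exact: cf.
  rewrite parts /=; last first.
  - by move=> x _; rewrite derive1E; apply: derive_val.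
  - exact: LR G'.
  - by apply: continuous_subspaceT => x; apply: cvgM; [exact: cid|exact: cp].
  - by move=> x _; rewrite derive1E derive_id.
  - by apply: (LR _ (cst 1)) => x; exact: is_derive_id.
  - by apply: continuous_subspaceT => x; exact: cvg_cst.
  have pN : p (- n.+1%:R) = p n.+1%:R.
    by rewrite /p normal_pdfE // /normal_fun !subr0 sqrrN.
  have ip : lebesgue_measure.-integrable (I n) (fun x => (p x)%:E).
    apply: (@integrableS _ _ _ _ setT) => //; first exact: measurable_itv.
    exact: integrable_normal_pdf.
  under eq_integral do rewrite mul1r EFinM.
  rewrite integralZl // pN EFinN mulNe oppeK; congr (_%:E + _)%E.
  by rewrite -mulr_natr; ring.
have cvgI (f : R -> \bar R) : measurable_fun [set: R] f -> (forall x, 0 <= f x)%E ->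
    (\int[lebesgue_measure]_(x in I n) f x)%E @[n --> \oo] -->
    (\int[lebesgue_measure]_x f x)%E.
  move=> mf f0; rewrite -UI; apply: ge0_nondecreasing_set_cvg_integral => //.
  by move=> n; exact: measurable_funTS.
have /cvgI lhs : measurable_fun [set: R] (fun x => ((x ^+ 2)%:E * (p x)%:E)%E).
  by apply: emeasurable_funM; apply/measurable_EFinP.
have /cvgI rhs : measurable_fun [set: R] (fun x => (p x)%:E) by exact/measurable_EFinP.
have sqp0 x : (0 <= (x ^+ 2)%:E * (p x)%:E)%E.
  by rewrite mule_ge0 // lee_fin ?sqr_ge0.
apply: (cvg_unique _ (lhs sqp0)) => //=; rewrite (eq_cvg _ _ parts).
have boundary : (- (s ^+ 2 *+ 2) * (n.+1%:R * p n.+1%:R))%:E @[n --> \oo] --> 0%:E.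
  apply/cvg_EFin; first exact: nearW.
  rewrite -[0 in X in _ --> X](mulr0 (- (s ^+ 2 *+ 2))).
  by apply: cvgMr; exact: cvg_id_normal_pdf.
rewrite integral_normal_pdf in rhs.
have main : ((s ^+ 2)%:E * \int[lebesgue_measure]_(x in I n) (p x)%:E)%E
    @[n --> \oo] --> ((s ^+ 2)%:E * 1)%E.
  by apply: cvgeZl => //; apply: rhs => x; rewrite lee_fin.
have := cvgeD (fin_num_adde_defr _ _) boundary main.
by rewrite add0e mule1; apply.
Qed.

End normal_moments.

(** * Normal random variables *)

Section normal_random_variables.
Context {R : realType} {disp : measure_display} {T : measurableType disp}.
Variable Pr : probability T R.

Lemma Lfun2_of_sqr (Y : T -> R) : measurable_fun setT Y ->
  (\int[Pr]_w ((Y w) ^+ 2)%:E < +oo)%E -> Y \in Lfun Pr 2%:E.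
Proof.
move=> mY Y2; rewrite inE; apply/andP; split; rewrite inE //=.
rewrite /finite_norm unlock poweR_lty //; apply: le_lt_trans Y2.
by under eq_integral => w _ do rewrite /= powR_mulrn // real_normK ?num_real //.
Qed.

Lemma normal_law_sqr (Y : T -> R) (v : R) : measurable_fun setT Y ->
  0 <= v -> normal_law Pr Y 0 v -> (\int[Pr]_w ((Y w) ^+ 2)%:E = v%:E)%E.
Proof.
move=> mY v0 lawY.
(* [normal_prob] is a measure on the copy [measurableTypeR R] of the line, whose
   Borel structure is convertible to that of R. *)
pose Y' : T -> measurableTypeR R := Y.
have mY' : measurable_fun setT Y' by exact: mY.
have msqr : measurable_fun [set: measurableTypeR R] (fun y => (y ^+ 2)%:E).
  by apply/measurable_EFinP; exact: exprn_measurable.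
have -> : (\int[Pr]_w ((Y w) ^+ 2)%:E = \int[pushforward Pr Y']_y (y ^+ 2)%:E)%E.
  by rewrite ge0_integral_pushforward // => y _; rewrite lee_fin sqr_ge0.
have [v_eq0|v_neq0] := eqVneq v 0.
  rewrite (eq_measure_integral \d_(0 : measurableTypeR R)) => [|B mB _]; last first.
    by apply: etrans (lawY B mB) _; rewrite v_eq0 eqxx.
  by rewrite integral_dirac // diracT mul1e expr0n v_eq0.
have s0 : Num.sqrt v != 0 by rewrite gt_eqF // sqrtr_gt0 lt0r v_neq0.
transitivity (\int[normal_prob 0 (Num.sqrt v)]_y (y ^+ 2)%:E)%E.
  apply: eq_measure_integral => B mB _.
  by apply: etrans (lawY B mB) _; rewrite (negbTE v_neq0).
rewrite (ge0_integral_density (mu := lebesgue_measure)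
  (g := normal_pdf 0 (Num.sqrt v))) //.
- by rewrite integral_sqr_normal_pdf // sqr_sqrtr.
- exact: integrable_normal_pdf.
- by move=> y; rewrite lee_fin sqr_ge0.
Qed.

(** The variable and its opposite have the same law, hence the same
    expectation. *)
Lemma normal_law_mean0 (Y : T -> R) (v : R) : Y \in Lfun Pr 1 ->
  normal_law Pr Y 0 v -> normal_law Pr (\- Y) 0 v -> ('E_Pr[Y] = 0)%E.
Proof.
move=> Y1 lawY lawNY.
have iY : Pr.-integrable setT (EFin \o Y) by apply/Lfun1_integrable.
have mY : measurable_fun setT Y by apply/measurable_EFinP/(measurable_int _ iY).
have iNY : Pr.-integrable setT (EFin \o (\- Y)).
  by apply/Lfun1_integrable; rewrite rpredN.
have mNY : measurable_fun setT (\- Y) by apply/measurable_EFinP/(measurable_int _ iNY).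
have YN : ('E_Pr[Y] = 'E_Pr[(\- Y)%R])%E.
  rewrite unlock; transitivity (\int[pushforward Pr Y]_y y%:E)%E.
    by rewrite integral_pushforward.
  transitivity (\int[pushforward Pr (\- Y)%R]_y y%:E)%E; last first.
    by rewrite integral_pushforward.
  apply: eq_measure_integral => B mB _.
  exact: etrans (lawY B mB) (esym (lawNY B mB)).
have EY : ('E_Pr[Y])%E \is a fin_num by exact: expectation_fin_num.
have : ('E_Pr[(\- Y)%R] = - 'E_Pr[Y])%E.
  rewrite -[RHS]mulN1e -expectationZl //; congr expectation.
  by apply/funext => w /=; rewrite mulrN1.
rewrite -YN -(fineK EY) -EFinN => -[] /eqP; rewrite -addr_eq0 -mulr2n mulrn_eq0 /=.
by move=> /eqP ->.
Qed.

End normal_random_variables.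

(** * Moments of random vectors under affine maps and stacking *)

Section random_vector_moments.
Context {R : realType} {disp : measure_display} {T : measurableType disp}.
Variable Pr : probability T R.

Let Pr_fin : Pr setT \is a fin_num.
Proof. exact: fin_num_measure. Qed.

Lemma expectation_linear (I : Type) (r : seq I) (c e : I -> R) (Z : I -> T -> R) :
  (forall i, Z i \in Lfun Pr 1) -> (forall i, 'E_Pr[Z i] = (e i)%:E)%E ->
  ('E_Pr[(\sum_(i <- r) (c i \o* Z i))%R] = (\sum_(i <- r) c i * e i)%:E)%E.
Proof.
move=> Z1 EZ; elim: r => [|i r IH]; first by rewrite !big_nil expectation_cst.
rewrite !big_cons expectationD ?Lfun_scale ?rpred_sum //.
  by rewrite expectationZl // EZ IH.
by move=> k _; rewrite Lfun_scale.
Qed.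

Lemma covariance_linear (I : Type) (r : seq I) (c e : I -> R)
    (Z : I -> T -> R) (Y : T -> R) :
  (forall i, Z i \in Lfun Pr 2%:E) -> Y \in Lfun Pr 2%:E ->
  (forall i, covariance Pr (Z i) Y = (e i)%:E) ->
  covariance Pr (\sum_(i <- r) (c i \o* Z i)) Y = (\sum_(i <- r) c i * e i)%:E.
Proof.
move=> Z2 Y2 CZ; elim: r => [|i r IH].
  by rewrite !big_nil (covariance_cst_l Pr 0).
have Z1 := Lfun_subset12 Pr_fin (Z2 i); have Y1 := Lfun_subset12 Pr_fin Y2.
have ZY1 := Lfun2_mul_Lfun1 (Z2 i) Y2.
rewrite !big_cons covarianceDl ?Lfun_scale ?rpred_sum ?ler1n ?lee1n //.
  by rewrite covarianceZl // CZ IH.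
by move=> ? k _; rewrite Lfun_scale ?ler1n.
Qed.

Lemma map_EFin_inj m n :
  injective (map_mx EFin : 'M[R]_(m, n) -> 'M[\bar R]_(m, n)).
Proof.
move=> A B /matrixP AB; apply/matrixP => i j.
by have := AB i j; rewrite !mxE => -[].
Qed.

Section linear_image.
Context {m p : nat}.
Variables (L : 'M[R]_(p, m)) (X : T -> 'cV[R]_m).
Hypothesis X2 : square_integrable Pr X.

Let entryE k : (fun w => (L *m X w) k 0) = \sum_a (L k a \o* (fun w => X w a 0)).
Proof.
apply/funext => w; rewrite mxE fct_sumE; apply: eq_bigr => a _ /=.
by rewrite mulrC.
Qed.

Lemma square_integrable_mulmx : square_integrable Pr (fun w => L *m X w).
Proof.
move=> k; rewrite entryE rpred_sum ?lee1n // => ? a _.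
by rewrite Lfun_scale ?ler1n.
Qed.

Lemma mean_vec_mulmx (mu : 'cV[R]_m) : mean_vec Pr X = map_mx EFin mu ->
  mean_vec Pr (fun w => L *m X w) = map_mx EFin (L *m mu).
Proof.
move=> EX; apply/colP => k; rewrite !mxE entryE.
rewrite (expectation_linear _ _ (e := fun a => mu a 0)) => [//|a|a].
- exact: Lfun_subset12 (X2 a).
- by have /colP/(_ a) := EX; rewrite !mxE.
Qed.

Lemma cov_mx_mulmx (S : 'M[R]_m) : cov_mx Pr X = map_mx EFin S ->
  cov_mx Pr (fun w => L *m X w) = map_mx EFin (L *m S *m L^T).
Proof.
move=> CX; apply/matrixP => k l; rewrite -mulmxA !mxE (entryE k).
apply: covariance_linear => [//||a]; first exact: square_integrable_mulmx.
rewrite covarianceC entryE mxE; under [in RHS]eq_bigr do rewrite mulrC mxE.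
apply: covariance_linear => // b.
by have /matrixP/(_ a b) := CX; rewrite covarianceC !mxE.
Qed.

End linear_image.

Lemma square_integrable_addl m (c : 'cV[R]_m) (X : T -> 'cV[R]_m) :
  square_integrable Pr X -> square_integrable Pr (fun w => c + X w).
Proof.
move=> X2 k; rewrite (_ : (fun w => _) = cst (c k 0) + (fun w => X w k 0)).
  by rewrite rpredD ?lee1n // => ?; rewrite Lfun_cst.
by apply/funext => w; rewrite !mxE.
Qed.

Lemma mean_vec_addl m (c mu : 'cV[R]_m) (X : T -> 'cV[R]_m) :
  square_integrable Pr X -> mean_vec Pr X = map_mx EFin mu ->
  mean_vec Pr (fun w => c + X w) = map_mx EFin (c + mu).
Proof.
move=> X2 EX; apply/colP => k; rewrite !mxE.
rewrite (_ : (fun w => _) = cst (c k 0) + (fun w => X w k 0)); last first.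
  by apply/funext => w; rewrite !mxE.
rewrite expectationD ?Lfun_cst //; last exact: Lfun_subset12 (X2 k).
by rewrite expectation_cst; have /colP/(_ k) := EX; rewrite !mxE => ->.
Qed.

Lemma cov_mx_addl m (c : 'cV[R]_m) (X : T -> 'cV[R]_m) :
  square_integrable Pr X -> cov_mx Pr (fun w => c + X w) = cov_mx Pr X.
Proof.
move=> X2; have cX2 := square_integrable_addl c X2.
apply/matrixP => k l; rewrite !mxE.
have entryE i : (fun w => (c + X w) i 0) = cst (c i 0) + (fun w => X w i 0).
  by apply/funext => w; rewrite !mxE.
rewrite (entryE k) covarianceDl ?Lfun_cst // covariance_cst_l add0e.
by rewrite entryE covarianceDr ?Lfun_cst // covariance_cst_r add0e.
Qed.

Lemma cov_mx_fine m (X : T -> 'cV[R]_m) : square_integrable Pr X ->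
  cov_mx Pr X = map_mx EFin (map_mx fine (cov_mx Pr X)).
Proof.
move=> X2; apply/matrixP => k l; rewrite !mxE fineK //.
by apply: covariance_fin_num; [exact: Lfun_subset12|exact: Lfun_subset12|
  exact: Lfun2_mul_Lfun1].
Qed.

Lemma square_integrable_col_mx m p (X : T -> 'cV[R]_m) (Y : T -> 'cV[R]_p) :
  square_integrable Pr X -> square_integrable Pr Y ->
  square_integrable Pr (fun w => col_mx (X w) (Y w)).
Proof.
move=> X2 Y2 k; case: (split_ordP k) => a ->.
  by under eq_fun do rewrite col_mxEu.
by under eq_fun do rewrite col_mxEd.
Qed.

Lemma mean_vec_col_mx m p (X : T -> 'cV[R]_m) (Y : T -> 'cV[R]_p) :
  mean_vec Pr (fun w => col_mx (X w) (Y w)) =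
  col_mx (mean_vec Pr X) (mean_vec Pr Y).
Proof.
apply/colP => k; case: (split_ordP k) => a ->; rewrite ?col_mxEu ?col_mxEd !mxE.
  by under eq_fun do rewrite col_mxEu.
by under eq_fun do rewrite col_mxEd.
Qed.

End random_vector_moments.

(** * Moments of centred Gaussian vectors *)

Section gaussian_moments.
Context {R : realType} {disp : measure_display} {T : measurableType disp}.
Variable Pr : probability T R.
Context {m : nat}.
Variables (X : T -> 'cV[R]_m) (S : 'M[R]_m).
Hypotheses (XN : gaussian_vector Pr X 0 S) (Spsd : sym_possemidef S).

Let form (a : 'cV[R]_m) (w : T) : R := (a^T *m X w) 0 0.

Let measurable_form a : measurable_fun setT (form a).
Proof.
have [mX _] := XN; rewrite /form; under eq_fun do rewrite mxE.
by apply: measurable_sum => k; apply: measurable_funM.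
Qed.

Let law_form a : normal_law Pr (form a) 0 ((a^T *m S *m a) 0 0).
Proof. by have [_ /(_ a)] := XN; rewrite mulmx0 mxE. Qed.

Lemma gaussian_form_L2 a : form a \in Lfun Pr 2%:E.
Proof.
apply: Lfun2_of_sqr => //.
by rewrite (normal_law_sqr _ _ (law_form a)) ?ltry //; case: Spsd.
Qed.

(** Symmetry: the forms given by a and by - a have the same variance, so they
    have the same law. *)
Lemma gaussian_form_mean a : ('E_Pr[form a] = 0)%E.
Proof.
apply: normal_law_mean0 (law_form a) _.
  by apply: Lfun_subset12 (gaussian_form_L2 a); exact: fin_num_measure.
have -> : \- form a = form (- a).
  by apply/funext => w; rewrite /form /= linearN mulNmx [in RHS]mxE.
have -> : (a^T *m S *m a) 0 0 = ((- a)^T *m S *m - a) 0 0.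
  by rewrite mulmxN linearN /= !mulNmx opprK.
exact: law_form.
Qed.

Lemma gaussian_form_variance a :
  covariance Pr (form a) (form a) = ((a^T *m S *m a) 0 0)%:E.
Proof.
rewrite -[LHS]/(variance Pr (form a)) varianceE ?gaussian_form_L2 //.
rewrite gaussian_form_mean expe2 mule0 sube0 unlock.
by apply: normal_law_sqr (law_form a) => //; case: Spsd.
Qed.

Let entry_form k : (fun w => X w k 0) = form (delta_mx k 0).
Proof. by apply/funext => w; rewrite /form trmx_delta -rowE mxE. Qed.

Let formD a b : form (a + b) = form a \+ form b.
Proof. by apply/funext => w; rewrite /form linearD mulmxDl mxE. Qed.

Lemma gaussian_square_integrable : square_integrable Pr X.
Proof. by move=> k; rewrite entry_form gaussian_form_L2. Qed.

Lemma gaussian_mean_vec : mean_vec Pr X = map_mx EFin 0.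
Proof. by apply/colP => k; rewrite !mxE entry_form gaussian_form_mean. Qed.

(** Polarization: the variances of the forms given by e_k, e_l and e_k + e_l
    determine the covariance of the two entries. *)
Lemma gaussian_cov_mx : cov_mx Pr X = map_mx EFin S.
Proof.
have L2 := gaussian_form_L2.
apply/matrixP => k l; rewrite !mxE !entry_form.
set a := delta_mx k 0; set b := delta_mx l 0.
have cov_fin : covariance Pr (form a) (form b) \is a fin_num.
  have Pr_fin : Pr setT \is a fin_num by exact: fin_num_measure.
  apply: covariance_fin_num; [exact: Lfun_subset12|exact: Lfun_subset12|].
  exact: Lfun2_mul_Lfun1.
have q i j :
    ((delta_mx i 0 : 'cV[R]_m)^T *m S *m (delta_mx j 0 : 'cV[R]_m)) 0 0 = S i j.
  by rewrite trmx_delta -rowE -colE !mxE.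
have Slk : S l k = S k l by have [/matrixP/(_ l k) + _] := Spsd; rewrite mxE => <-.
have entryD (M N : 'M[R]_1) : (M + N) 0 0 = M 0 0 + N 0 0 by rewrite mxE.
have := gaussian_form_variance (a + b).
rewrite formD covarianceDl ?covarianceDr ?rpredD ?lee1n //.
rewrite (covarianceC _ (form b) (form a)) !gaussian_form_variance -(fineK cov_fin).
rewrite -!EFinD => -[]; rewrite mulmxDr linearD /= !mulmxDl.
by rewrite !entryD !q Slk => eq4; congr EFin; lra.
Qed.

End gaussian_moments.

(** * Convergence of the projected moments *)

Theorem corollary3p8 (R : realType) (n d J r : nat)
    (H : 'M[R]_(n, d)) (y : 'cV[R]_n) (mu_pr : 'cV[R]_d)
    (Gam : 'M[R]_n) (Gam_pr : 'M[R]_d)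
    (hGam : sym_posdef Gam) (hGam_pr : sym_posdef Gam_pr)
    (disp : measure_display) (T : measurableType disp) (Pr : probability T R)
    (mu0 : 'cV[R]_d) (C0 : 'M[R]_d) (hC0 : sym_possemidef C0)
    (v0 : 'I_J -> T -> 'cV[R]_d)
    (v0_meas : forall j, random_vector (v0 j))
    (v0_L2 : forall j, square_integrable Pr (v0 j))
    (v0_mean : forall j, mean_vec Pr (v0 j) = map_mx EFin mu0)
    (v0_cov : forall j, cov_mx Pr (v0 j) = map_mx EFin C0)
    (eps : 'I_J -> T -> 'cV[R]_(n + d))
    (eps_law : forall j, gaussian_vector Pr (eps j) 0 (Gam_RLS Gam Gam_pr))
    (eps_indep :
      mutually_independent Pr (fun j => sigma_of_vector (eps j)))
    (eps_v0_indep :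
      independent Pr (sigma_of_family eps) (sigma_of_family v0))
    (hr : r = nb_pos_eigenvalues (C0 *m A_RLS H Gam Gam_pr))
    (U : 'M[R]_(d, r))
    (hU : forall k, pos_eigenvector (C0 *m A_RLS H Gam Gam_pr) (col k U))
    (hU_norm : U^T *m A_RLS H Gam Gam_pr *m U = 1%:M) :
  let A := A_RLS H Gam Gam_pr in
  let P := U *m U^T *m A in
  let vstar (j : 'I_J) (w : T) :=
    v_star H Gam Gam_pr (y_RLS y mu_pr + eps j w) in
  let v (i : nat) (j : 'I_J) (w : T) :=
    mf_particle A C0 i (v0 j w) (vstar j w) in
  forall j : 'I_J,
    (mean_vec Pr (fun w => P *m v i.+1 j w) @[i --> \oo] -->
       map_mx EFin (P *m mu_pos H y mu_pr Gam Gam_pr)) /\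
    (cov_mx Pr (fun w => P *m v i.+1 j w) @[i --> \oo] -->
       map_mx EFin (P *m Gam_pos H Gam Gam_pr *m P^T)).
Proof.
move=> A P vstar v j.
have Apd : sym_posdef A by exact: A_RLS_posdef.
set mu := mu_pos H y mu_pr Gam Gam_pr; set Gp := Gam_pos H Gam Gam_pr.
pose K := mpinv A *m (H_RLS H)^T *m invmx (Gam_RLS Gam Gam_pr).
have Gam_psd : sym_possemidef (Gam_RLS Gam Gam_pr).
  by apply: Gam_RLS_possemidef; exact: posdef_possemidef.
have eps2 := gaussian_square_integrable (eps_law j) Gam_psd.
have Keps2 := square_integrable_mulmx K eps2.
have vstarE : vstar j = fun w => mu + K *m eps j w.
  apply/funext => w; rewrite /vstar /v_star mulmxDr -/K; congr (_ + _).
  exact: v_star_y_RLS.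
have vstar2 : square_integrable Pr (vstar j).
  by rewrite vstarE; exact: square_integrable_addl.
have vstar_mean : mean_vec Pr (vstar j) = map_mx EFin mu.
  rewrite vstarE (mean_vec_addl mu (mu := 0)) ?addr0 //.
  rewrite (mean_vec_mulmx K eps2 (mu := 0)) ?mulmx0 //.
  exact: gaussian_mean_vec (eps_law j) Gam_psd.
have vstar_cov : cov_mx Pr (vstar j) = map_mx EFin Gp.
  rewrite vstarE cov_mx_addl // /Gp -(v_star_noise_cov H hGam hGam_pr).
  by apply: cov_mx_mulmx => //; exact: gaussian_cov_mx (eps_law j) Gam_psd.
pose Z w := col_mx (v0 j w) (vstar j w).
have Z2 : square_integrable Pr Z by exact: square_integrable_col_mx.
have Z_mean : mean_vec Pr Z = map_mx EFin (col_mx mu0 mu).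
  by rewrite mean_vec_col_mx v0_mean vstar_mean map_col_mx.
have Z_cov := cov_mx_fine Z2; set S := map_mx fine _ in Z_cov.
pose N i := mf_Mprod A C0 i.+1.
pose L i := row_mx (P *m N i) (P - P *m N i).
pose Loo : 'M[R]_(d, d + d) := row_mx 0 P.
have PvE i : (fun w => P *m v i.+1 j w) = (fun w => L i *m Z w).
  apply/funext => w; rewrite /v /mf_particle mul_row_col mulmxDr !mulmxA.
  by rewrite mulmxBr mulmx1.
have cvg_L a b : L i a b @[i --> \oo] --> Loo a b.
  have cvg_PN k l : (P *m N i) k l @[i --> \oo] --> (0 : R).
    have := cvg_mf_Mprod_proj Apd hC0 hU k l.
    by rewrite -cvg_shiftS.
  case: (split_ordP b) => c ->; rewrite /L /Loo.
    by under eq_fun do rewrite row_mxEl; rewrite row_mxEl mxE; exact: cvg_PN.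
  rewrite row_mxEr (_ : (fun i => _) = fun i => P a c - (P *m N i) a c).
    by have := cvgB (cvg_cst (P a c)) (cvg_PN a c); rewrite subr0; apply.
  by apply/funext => i; rewrite row_mxEr [LHS]mxE [X in _ + X]mxE.
split.
- have -> : P *m mu = Loo *m col_mx mu0 mu by rewrite mul_row_col mul0mx add0r.
  rewrite (_ : (fun i => _) = fun i => map_mx EFin (L i *m col_mx mu0 mu)); last first.
    by apply/funext => i; rewrite PvE; exact: mean_vec_mulmx.
  by apply: cvg_map_EFin_entries; apply: cvg_mulmx_entries => // k l; exact: cvg_cst.
(* The limit Loo S Loo^T is the covariance of Loo Z = P z_star, which is
   P Gam_pos P^T by the affine formula for z_star. *)
- have -> : P *m Gp *m P^T = Loo *m S *m Loo^T.
    apply: map_EFin_inj.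
    rewrite -(cov_mx_mulmx _ Z2 Z_cov) -(cov_mx_mulmx _ vstar2 vstar_cov).
    congr cov_mx; apply/funext => w.
    by rewrite mul_row_col mul0mx add0r.
  rewrite (_ : (fun i => _) = fun i => map_mx EFin (L i *m S *m (L i)^T)); last first.
    by apply/funext => i; rewrite PvE; exact: cov_mx_mulmx.
  apply: cvg_map_EFin_entries; apply: cvg_mulmx_entries => k l.
    by apply: cvg_mulmx_entries => // *; exact: cvg_cst.
  by rewrite mxE; under eq_fun do rewrite mxE; exact: cvg_L.
Qed.
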